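(* Let $M$ be a finite meadow and let $\{e_1,\ldots,e_n\}\subseteq M$ be the set of (pairwise distinct) minimal idempotents of $M$. Then $$M\cong e_1\cdot M\times\cdots\times e_n\cdot M,$$ where $\cong$ denotes isomorphism of meadows and the operations on the product are defined componentwise.
   Context: A meadow is a commutative ring with identity element $1$ (it is not required that $0\neq 1$) equipped with a total unary operation ${}^{-1}$ satisfying, for all $x$, $(x^{-1})^{-1}=x$ and $x\cdot(x\cdot x^{-1})=x$. An idempotent of $M$ is an element $e\neq 0$ with $e\cdot e=e$. For idempotents $e,e'$ write $e\le e'$ if $e\cdot e'=e$. An idempotent $e$ is minimal if for every idempotent $e'\in M$, $e'\le e$ implies $e'=e$. For an idempotent $e$, $e\cdot M=\{e\cdot m: m\in M\}$ is regarded as a meadow with the operations $+,-,\cdot,{}^{-1}$ and $0$ inherited from $M$, and with multiplicative identity element $e$. Isomorphism of meadows means a bijection preserving $0,1,+,-,\cdot,{}^{-1}$. An empty product is the one-element meadow. *)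

(* Defs.v *)
From HB Require Import structures.
From mathcomp Require Import all_boot all_order all_algebra.

Set Implicit Arguments.
Unset Strict Implicit.
Unset Printing Implicit Defensive.

Import GRing.Theory.

Local Open Scope ring_scope.

(* [comPzRingType] allows 0 = 1, so the one-element meadow is included. *)
HB.mixin Record ComPzRing_isMeadow R of GRing.ComPzRing R := {
  minv : R -> R;
  minvK : involutive minv;
  mulr_minv : forall x : R, x * (x * minv x) = x
}.

#[short(type="meadowType")]
HB.structure Definition Meadow :=
  {R of GRing.ComPzRing R & ComPzRing_isMeadow R}.

#[short(type="finMeadowType")]
HB.structure Definition FinMeadow := {R of Meadow R & Finite R}.

Definition meadow_isomorphic (M N : meadowType) : Prop :=
  exists f : {rmorphism M -> N}, bijective f /\ {morph f : x / minv x}.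

Section Idempotents.

Variable M : meadowType.

Record idem := Idem {
  idem_val : M;
  idem_valP : (idem_val != 0) && (idem_val * idem_val == idem_val)
}.

HB.instance Definition _ := [isSub for idem_val].
HB.instance Definition _ := [Choice of idem by <:].

Definition idem_le (e e' : idem) : Prop := val e * val e' = val e.

Definition minimal_idem (e : idem) : Prop :=
  forall e' : idem, idem_le e' e -> e' = e.

Lemma idem_mulE (e : idem) : val e * val e = val e.
Proof. by case/andP: (idem_valP e) => _ /eqP. Qed.

End Idempotents.

Section Corner.

Variables (M : finMeadowType) (e : idem M).

Record corner := Corner {
  corner_val : M;
  corner_valP : corner_val \in [set val e * m | m : M]
}.

HB.instance Definition _ := [isSub for corner_val].
HB.instance Definition _ := [Finite of corner by <:].

Lemma cornerE (x : corner) : val e * val x = val x.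
Proof.
by case/imsetP: (valP x) => m _ ->; rewrite mulrA idem_mulE.
Qed.

Lemma mem_corner (x : M) : val e * x = x -> x \in [set val e * m | m : M].
Proof. by move=> <-; apply: imset_f. Qed.

Fact corner_zero_subproof : val e * 0 = 0.
Proof. exact: mulr0. Qed.
Fact corner_one_subproof : val e * val e = val e.
Proof. exact: idem_mulE. Qed.
Fact corner_opp_subproof (x : corner) : val e * - val x = - val x.
Proof. by rewrite mulrN cornerE. Qed.
Fact corner_add_subproof (x y : corner) : val e * (val x + val y) = val x + val y.
Proof. by rewrite mulrDr !cornerE. Qed.
Fact corner_mul_subproof (x y : corner) : val e * (val x * val y) = val x * val y.
Proof. by rewrite mulrA cornerE. Qed.
Fact corner_inv_subproof (x : corner) : val e * minv (val x) = minv (val x).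
Proof.
have <- := mulr_minv (minv (val x)); rewrite minvK.
by rewrite mulrCA (mulrCA (val e)) cornerE.
Qed.

Definition corner_zero := Corner (mem_corner corner_zero_subproof).
Definition corner_one := Corner (mem_corner corner_one_subproof).
Definition corner_opp x := Corner (mem_corner (corner_opp_subproof x)).
Definition corner_add x y := Corner (mem_corner (corner_add_subproof x y)).
Definition corner_mul x y := Corner (mem_corner (corner_mul_subproof x y)).
Definition corner_inv x := Corner (mem_corner (corner_inv_subproof x)).

Fact corner_addA : associative corner_add.
Proof. by move=> x y z; apply: val_inj; rewrite /= addrA. Qed.
Fact corner_addC : commutative corner_add.
Proof. by move=> x y; apply: val_inj; rewrite /= addrC. Qed.
Fact corner_add0 : left_id corner_zero corner_add.
Proof. by move=> x; apply: val_inj; rewrite /= add0r. Qed.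
Fact corner_addN : left_inverse corner_zero corner_opp corner_add.
Proof. by move=> x; apply: val_inj; rewrite /= addNr. Qed.

HB.instance Definition _ := GRing.isZmodule.Build corner
  corner_addA corner_addC corner_add0 corner_addN.

Fact corner_mulA : associative corner_mul.
Proof. by move=> x y z; apply: val_inj; rewrite /= mulrA. Qed.
Fact corner_mulC : commutative corner_mul.
Proof. by move=> x y; apply: val_inj; rewrite /= mulrC. Qed.
Fact corner_mul1 : left_id corner_one corner_mul.
Proof. by move=> x; apply: val_inj; rewrite /= cornerE. Qed.
Fact corner_mulDl : left_distributive corner_mul corner_add.
Proof. by move=> x y z; apply: val_inj; rewrite /= mulrDl. Qed.

HB.instance Definition _ := GRing.Zmodule_isComPzRing.Build corner
  corner_mulA corner_mulC corner_mul1 corner_mulDl.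

Fact corner_invK : involutive corner_inv.
Proof. by move=> x; apply: val_inj; rewrite /= minvK. Qed.
Fact corner_mul_inv (x : corner) : x * (x * corner_inv x) = x.
Proof. by apply: val_inj; rewrite /= mulr_minv. Qed.

HB.instance Definition _ := ComPzRing_isMeadow.Build corner
  corner_invK corner_mul_inv.

End Corner.

Section Product.

Variables (I : finType) (T : I -> meadowType).

Definition meadow_prod : Type := {dffun forall i : I, T i}.

HB.instance Definition _ := Choice.copy meadow_prod {dffun forall i : I, T i}.

Implicit Types x y z : meadow_prod.

Definition prod_zero : meadow_prod := [ffun i => 0 : T i].
Definition prod_one : meadow_prod := [ffun i => 1 : T i].
Definition prod_opp x : meadow_prod := [ffun i => - x i].
Definition prod_add x y : meadow_prod := [ffun i => x i + y i].
Definition prod_mul x y : meadow_prod := [ffun i => x i * y i].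
Definition prod_inv x : meadow_prod := [ffun i => minv (x i)].

Fact prod_addA : associative prod_add.
Proof. by move=> x y z; apply/ffunP=> i; rewrite !ffunE addrA. Qed.
Fact prod_addC : commutative prod_add.
Proof. by move=> x y; apply/ffunP=> i; rewrite !ffunE addrC. Qed.
Fact prod_add0 : left_id prod_zero prod_add.
Proof. by move=> x; apply/ffunP=> i; rewrite !ffunE add0r. Qed.
Fact prod_addN : left_inverse prod_zero prod_opp prod_add.
Proof. by move=> x; apply/ffunP=> i; rewrite !ffunE addNr. Qed.

HB.instance Definition _ := GRing.isZmodule.Build meadow_prod
  prod_addA prod_addC prod_add0 prod_addN.

Fact prod_mulA : associative prod_mul.
Proof. by move=> x y z; apply/ffunP=> i; rewrite !ffunE mulrA. Qed.
Fact prod_mulC : commutative prod_mul.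
Proof. by move=> x y; apply/ffunP=> i; rewrite !ffunE mulrC. Qed.
Fact prod_mul1 : left_id prod_one prod_mul.
Proof. by move=> x; apply/ffunP=> i; rewrite !ffunE mul1r. Qed.
Fact prod_mulDl : left_distributive prod_mul prod_add.
Proof. by move=> x y z; apply/ffunP=> i; rewrite !ffunE mulrDl. Qed.

HB.instance Definition _ := GRing.Zmodule_isComPzRing.Build meadow_prod
  prod_mulA prod_mulC prod_mul1 prod_mulDl.

Fact prod_invK : involutive prod_inv.
Proof. by move=> x; apply/ffunP=> i; rewrite !ffunE minvK. Qed.
Fact prod_mul_inv x : x * (x * prod_inv x) = x.
Proof. by apply/ffunP=> i; rewrite !ffunE mulr_minv. Qed.

HB.instance Definition _ := ComPzRing_isMeadow.Build meadow_prod
  prod_invK prod_mul_inv.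

End Product.

(* Main.v *)
From HB Require Import structures.
Require Import Defs.
From mathcomp Require Import all_boot all_order all_algebra.

(** The minimal idempotents [e_i] form a complete orthogonal system. They are
    orthogonal because a nonzero product [e_i * e_j] would be an idempotent
    below both factors, hence equal to both ([minimal_idem_orthogonal]). They
    sum to [1]: orthogonality makes [1 - \sum_i e_i] idempotent, and if it
    were nonzero, finiteness would put a minimal idempotent, that is some
    [e_i], below it ([exists_minimal_idem_le]), although it annihilates every
    [e_i]. This gives the usual Peirce decomposition of the ring:
    [m |-> (e_i * m)_i] is a morphism, with inverse
    [x |-> \sum_i x_i].

    That this map also preserves the meadow inverse is because [minv] is
    determined by the ring structure: generalized inverses in a commutative
    ring are unique ([minv_unique]), so multiplication by an idempotent
    commutes with [minv] ([minv_idem]). *)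

Set Implicit Arguments.
Unset Strict Implicit.
Unset Printing Implicit Defensive.

Import GRing.Theory.

Local Open Scope ring_scope.

(** * The meadow inverse as the unique generalized inverse *)

(** With [z := minv x], the idempotents [x * y] and [x * z] absorb each other,
    so they coincide, and [y = y * (x * y) = y * (x * z) = (x * z) * z = z]. *)
Lemma minv_unique (M : meadowType) (x y : M) :
  x * (x * y) = x -> y * (y * x) = y -> minv x = y.
Proof.
move=> xxy yyx; set z := minv x.
have xxz : x * (x * z) = x by exact: mulr_minv.
have zzx : z * (z * x) = z by have := mulr_minv z; rewrite minvK.
have xy_xz : x * y = x * z.
  transitivity (x * y * (x * z)); first by rewrite mulrAC xxz.
  by rewrite mulrCA mulrA xxy.
rewrite -[LHS]zzx [z * x]mulrC -xy_xz mulrCA mulrA -xy_xz.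
by rewrite mulrC [x * y]mulrC yyx.
Qed.

Lemma minv_idem (M : meadowType) (e : idem M) (x : M) :
  minv (val e * x) = val e * minv x.
Proof.
have ee := idem_mulE e.
apply: minv_unique; rewrite [X in _ * X]mulrACA ee mulrACA ee ?mulr_minv //.
by have := mulr_minv (minv x); rewrite minvK => ->.
Qed.

(** * Minimal idempotents *)

Lemma minimal_idem_orthogonal (M : meadowType) (e f : idem M) :
  minimal_idem e -> minimal_idem f -> e <> f -> val e * val f = 0.
Proof.
move=> e_min f_min e_neq_f; apply/eqP; apply/negPn/negP => ef_neq0.
have ef_idem : (val e * val f != 0) &&
    (val e * val f * (val e * val f) == val e * val f).
  by rewrite ef_neq0 mulrACA !idem_mulE eqxx.
pose g := Idem ef_idem.
apply: e_neq_f; transitivity g.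
  by apply/esym/e_min; rewrite /idem_le /= mulrAC idem_mulE.
by apply: f_min; rewrite /idem_le /= -mulrA idem_mulE.
Qed.

Lemma minimal_family_orthogonal (M : meadowType) (n : nat) (e : 'I_n -> idem M) :
  injective e -> (forall i, minimal_idem (e i)) ->
  forall i j, i != j -> val (e i) * val (e j) = 0.
Proof.
move=> e_inj e_min i j i_neq_j; apply: minimal_idem_orthogonal => //.
by move/e_inj=> ij; rewrite ij eqxx in i_neq_j.
Qed.

(** An idempotent [x] below [s] whose principal ideal is smallest is minimal:
    if [y] lies below [x], then [y * M = x * M] by cardinality, so [x] lies
    in [y * M], on which [y] acts as the identity, and [y = y * x = x]. *)
Lemma exists_minimal_idem_le (M : finMeadowType) (s : idem M) :
  exists2 f : idem M, minimal_idem f & idem_le f s.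
Proof.
pose P := [pred x : M | [&& x != 0, x * x == x & x * val s == x]].
have Ps : P (val s).
  by case/andP: (idem_valP s) => s0 ss; rewrite /= s0 ss.
pose ideal (x : M) := [set x * m | m : M].
case: (arg_minnP (fun x => #|ideal x|) Ps) => x /and3P[x0 xx /eqP xs] x_min.
have x_idem : (x != 0) && (x * x == x) by rewrite x0 xx.
exists (Idem x_idem) => // -[y y_idem]; rewrite /idem_le /= => yx.
have /andP[y0 /eqP yy] := y_idem.
have y_sub : ideal y \subset ideal x.
  by apply/subsetP=> _ /imsetP[m _ ->]; rewrite -yx mulrAC mulrC imset_f.
have ideal_eq : ideal y = ideal x.
  by apply/eqP; rewrite eqEcard y_sub x_min //= y0 yy -yx -mulrA xs !eqxx.
apply: val_inj => /=.
have : x \in ideal y.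
  by rewrite ideal_eq; apply/imsetP; exists x; rewrite ?(eqP xx).
by case/imsetP=> m _ x_ym; rewrite -[LHS]yx x_ym mulrA yy.
Qed.

(** The defect [1 - \sum_i e_i] annihilates every [e_i], so no minimal
    idempotent lies below it; by [exists_minimal_idem_le] it must vanish. *)
Lemma sum_minimal_idem (M : finMeadowType) (n : nat) (e : 'I_n -> idem M) :
  injective e ->
  (forall f : idem M, minimal_idem f <-> exists i : 'I_n, e i = f) ->
  \sum_i val (e i) = 1.
Proof.
move=> e_inj e_minimal.
pose s := 1 - \sum_i val (e i).
have e_s i : val (e i) * s = 0.
  rewrite mulrBr mulr1 mulr_sumr (bigD1 i) //= idem_mulE big1 ?addr0 ?subrr //.
  move=> j j_neq_i; apply: minimal_family_orthogonal; rewrite 1?eq_sym //.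
  by move=> k; apply/e_minimal; exists k.
have ss : s * s == s.
  by rewrite {1}/s mulrBl mul1r mulr_suml big1 ?subr0.
apply/esym/eqP; rewrite -subr_eq0; apply/negPn/negP => s0.
have s_idem : (s != 0) && (s * s == s) by rewrite s0 ss.
have [f /e_minimal[i <-]] := exists_minimal_idem_le (Idem s_idem).
rewrite /idem_le /= e_s => /esym/eqP ei0.
by case/andP: (idem_valP (e i)); rewrite ei0.
Qed.

(** * The Peirce decomposition *)

Section Peirce.

Variables (M : finMeadowType) (n : nat) (e : 'I_n -> idem M).

Definition corner_proj (f : idem M) (m : M) : corner f :=
  Corner (imset_f (fun x => val f * x) (isT : m \in {: M})).

Definition peirce (m : M) : meadow_prod (fun i : 'I_n => corner (e i)) :=
  [ffun i => corner_proj (e i) m].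

Fact peirce_additive : zmod_morphism peirce.
Proof.
by move=> x y; apply/ffunP=> i; rewrite !ffunE; apply: val_inj; rewrite /= mulrBr.
Qed.

Fact peirce_multiplicative : monoid_morphism peirce.
Proof.
split=> [|x y]; apply/ffunP=> i; rewrite !ffunE; apply: val_inj => /=.
  by rewrite mulr1.
by rewrite mulrACA idem_mulE.
Qed.

HB.instance Definition _ := GRing.isZmodMorphism.Build M
  (meadow_prod (fun i : 'I_n => corner (e i))) peirce peirce_additive.
HB.instance Definition _ := GRing.isMonoidMorphism.Build M
  (meadow_prod (fun i : 'I_n => corner (e i))) peirce peirce_multiplicative.

Lemma peirce_minv : {morph peirce : x / minv x}.
Proof.
by move=> x; apply/ffunP=> i; rewrite !ffunE; apply: val_inj; rewrite /= minv_idem.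
Qed.

(** Completeness makes the sum of the components a left inverse of [peirce];
    orthogonality makes it a right inverse, since [e_i * x_j = e_i * e_j * x_j]
    vanishes for [j != i]. *)
Lemma peirce_bij :
  (forall i j, i != j -> val (e i) * val (e j) = 0) ->
  \sum_i val (e i) = 1 -> bijective peirce.
Proof.
move=> e_orth e_sum.
pose glue (x : meadow_prod (fun i : 'I_n => corner (e i))) := \sum_i val (x i).
exists glue => [m | x]; rewrite /glue.
  by under eq_bigr do rewrite ffunE /=; rewrite -mulr_suml e_sum mul1r.
apply/ffunP=> i; rewrite ffunE; apply: val_inj => /=.
rewrite mulr_sumr (bigD1 i) //= cornerE big1 ?addr0 // => j j_neq_i.
by rewrite -cornerE mulrA e_orth ?mul0r // eq_sym.
Qed.

End Peirce.

Theorem theorem2p7 (M : finMeadowType) (n : nat) (e : 'I_n -> idem M)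
    (e_inj : injective e)
    (e_minimal : forall f : idem M, minimal_idem f <-> exists i : 'I_n, e i = f) :
  meadow_isomorphic M (meadow_prod (fun i : 'I_n => corner (e i))).
Proof.
exists (peirce e : {rmorphism _ -> _}); split; last exact: peirce_minv.
apply: peirce_bij; last exact: sum_minimal_idem.
apply: minimal_family_orthogonal => // i.
by apply/e_minimal; exists i.
Qed.
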